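(* Let $\mathcal{K}_o$ be the family of origin-symmetric convex disks in $\mathbb{R}^2$. The topology on $\mathcal{K}_o$ induced by the perimeter measure distance $d_{PM}$ is a refinement of the topology on $\mathcal{K}_o$ induced by the Hausdorff distance $d_H$; that is, every set open in the topology induced by $d_H$ is open in the topology induced by $d_{PM}$.
   Context: A convex disk is a compact, convex set with nonempty interior in $\mathbb{R}^2$. For a convex disk $K$ and a Borel set $\sigma\subseteq\mathbb{S}^1$, let $N_K(\sigma)$ be the set of boundary points $p$ of $K$ at which some element of $\sigma$ is an outer unit normal vector of $K$, and let the surface area measure $A_K(\sigma)$ be the one-dimensional Hausdorff measure of $N_K(\sigma)$. Let $\mathcal{H}(\sigma)$ denote the one-dimensional Hausdorff measure of $\sigma$. For $C,D\in\mathcal{K}_o$, $$d_{PM}(C,D)=\inf\{\tau\ge 0: |A_C(\sigma)-A_D(\sigma)|\le \tau\,\mathcal{H}(\sigma)\text{ for every Borel set }\sigma\subseteq\mathbb{S}^1\},$$ with $d_{PM}(C,D)=\infty$ if no such $\tau$ exists. This is a generalized metric (values in $[0,\infty]$), and the topology it induces is the one generated by its open balls. *)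

(* Defs.v *)
From HB Require Import structures.
From mathcomp Require Import all_boot all_order all_algebra.
From mathcomp Require Import all_classical all_reals all_analysis.

Set Implicit Arguments.
Unset Strict Implicit.
Unset Printing Implicit Defensive.

Import Order.TTheory GRing.Theory Num.Theory.
Import numFieldNormedType.Exports.

Local Open Scope classical_set_scope.
Local Open Scope ring_scope.

Section Plane.
Context {R : realType}.
Implicit Types (x y p q u : 'rV[R]_2) (A C D K sigma : set 'rV[R]_2).

Definition dot x y : R := \sum_(i < 2) x 0 i * y 0 i.

(* The library norm on 'rV[R]_2 is the sup norm. It induces the usual topology
   (hence the usual compact sets, interiors and Borel sets), but all distances
   below must be taken with respect to the Euclidean norm. *)
Definition enorm x : R := Num.sqrt (dot x x).

Definition circle : set 'rV[R]_2 := [set u | enorm u = 1].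

(* Since the circle is closed, its Borel subsets are exactly the Borel sets of
   the plane contained in it. *)
Definition circle_borel sigma : Prop :=
  <<s (open : set (set 'rV[R]_2)) >> sigma /\ sigma `<=` circle.

(* The maximum with 0 only matters for the empty set: ereal_sup set0 = -oo. *)
Definition diam A : \bar R :=
  maxe 0%E (ereal_sup [set (enorm (x - y))%:E | x in A & y in A]).

Definition hausdorff1_pre (delta : R) A : \bar R :=
  ereal_inf [set (\sum_(0 <= i <oo) diam (V i))%E |
    V in [set V : nat -> set 'rV[R]_2 |
      (forall i, (diam (V i) <= delta%:E)%E) /\ A `<=` \bigcup_i V i]].

Definition hausdorff1 A : \bar R :=
  ereal_sup [set hausdorff1_pre delta A | delta in [set delta : R | 0 < delta]].

Definition convex_disk K : Prop :=
  [/\ compact K, convex_set K & interior K !=set0].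

Definition origin_symmetric K : Prop := [set - x | x in K] = K.

Definition boundary K : set 'rV[R]_2 := closure K `\` interior K.

Definition outer_unit_normal K p u : Prop :=
  circle u /\ forall x, K x -> dot u x <= dot u p.

Definition normal_preimage K sigma : set 'rV[R]_2 :=
  [set p | boundary K p /\ exists2 u, sigma u & outer_unit_normal K p u].

Definition area_measure K sigma : \bar R :=
  hausdorff1 (normal_preimage K sigma).

Definition dist_to p A : \bar R := ereal_inf [set (enorm (p - q))%:E | q in A].

Definition hausdorff_dist C D : \bar R :=
  maxe (ereal_sup [set dist_to p D | p in C])
       (ereal_sup [set dist_to q C | q in D]).

(* Equal to +oo when no tau is admissible, because ereal_inf set0 = +oo. *)
Definition perimeter_measure_dist C D : \bar R :=
  ereal_inf [set tau%:E | tau in [set tau : R | 0 <= tau /\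
    forall sigma, circle_borel sigma ->
      (`|area_measure C sigma - area_measure D sigma|
         <= tau%:E * hausdorff1 sigma)%E]].

End Plane.

Definition symmetric_disks (R : realType) : set (set 'rV[R]_2) :=
  [set K | convex_disk K /\ origin_symmetric K].
Arguments symmetric_disks R : clear implicits.

Definition Ko (R : realType) : Type := set_type (symmetric_disks R).
HB.instance Definition _ (R : realType) := Choice.on (Ko R).

Definition dH (R : realType) (C D : Ko R) : \bar R :=
  hausdorff_dist (val C) (val D).

Definition dPM (R : realType) (C D : Ko R) : \bar R :=
  perimeter_measure_dist (val C) (val D).

Section GeneralizedMetric.
Context {R : realType} {T : choiceType}.
Implicit Type d : T -> T -> \bar R.

Definition gball d (x : T) (r : R) : set T := [set y | (d x y < r%:E)%E].

Definition open_balls d : set (set T) :=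
  [set B | exists x r, 0 < r /\ B = gball d x r].

(* An alias of T, carrying the topology generated by the open balls of d. *)
Definition gmetric_type d : Type := T.

HB.instance Definition _ d := Choice.copy (gmetric_type d) T.
HB.instance Definition _ d :=
  isSubBaseTopological.Build (gmetric_type d) (open_balls d) id.

Definition gmetric_open d : set (set T) := @open (gmetric_type d).

End GeneralizedMetric.

(* Main.v *)
(* Let J be the rotation by a quarter turn and p_K(u) the first point, in
   counterclockwise order, of the face of K with outer normal u. Cut the half
   circle from u to -u into n half-open arcs [u_i, u_(i+1)) of the same small
   angle t. The part of the boundary of K with normals in such an arc is a
   Lipschitz graph over the chord p_K(u_(i+1)) - p_K(u_i), so its length
   L_i = A_K([u_i, u_(i+1))) satisfies
   p_K(u_(i+1)) - p_K(u_i) = L_i J u_i + O(L_i tan t).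
   Since K is symmetric, summing over i gives
   -2 p_K(u) = sum_i L_i J u_i + O(tan t sum_i L_i). Hence, once n is chosen in
   terms of C alone, disks C and D whose surface area measures are close on each
   of the arcs have close support functions <u, p_K(u)>, and are therefore
   Hausdorff-close. *)
Require Import Defs.
From mathcomp Require Import all_boot all_order all_algebra.
From mathcomp Require Import finmap.
From mathcomp Require Import all_classical all_reals all_analysis.
From mathcomp Require Import ring lra.

Set Implicit Arguments.
Unset Strict Implicit.
Unset Printing Implicit Defensive.

Import Order.TTheory GRing.Theory Num.Theory.
Import numFieldNormedType.Exports.

Local Open Scope classical_set_scope.
Local Open Scope ring_scope.

(** * Euclidean geometry of the plane in orthonormal frames *)

Section PlaneGeometry.
Context {R : realType}.
Implicit Types (x y z p q u v w : 'rV[R]_2) (A K : set 'rV[R]_2).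

Lemma dotE x y : dot x y = x 0 0 * y 0 0 + x 0 1 * y 0 1.
Proof.
rewrite /dot big_ord_recl big_ord1.
by rewrite (_ : lift ord0 ord0 = 1 :> 'I_2)//; apply: val_inj.
Qed.

Lemma rV2P x y : x 0 0 = y 0 0 -> x 0 1 = y 0 1 -> x = y.
Proof.
move=> e0 e1; apply/rowP => i.
by case: i => [[|[|//]] h]; [rewrite (_ : Ordinal h = 0)//; apply: val_inj
  | rewrite (_ : Ordinal h = 1)//; apply: val_inj].
Qed.

Definition rot90 x : 'rV[R]_2 := \row_(i < 2) (if i == 0 then - x 0 1 else x 0 0).

Lemma rot90_0 x : rot90 x 0 0 = - x 0 1. Proof. by rewrite mxE. Qed.
Lemma rot90_1 x : rot90 x 0 1 = x 0 0. Proof. by rewrite mxE. Qed.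

Definition dot2E := (dotE, rot90_0, rot90_1, mxE).

Lemma dotC x y : dot x y = dot y x. Proof. by rewrite !dotE; ring. Qed.
Lemma dotDr x y z : dot x (y + z) = dot x y + dot x z. Proof. by rewrite !dot2E; ring. Qed.
Lemma dotBr x y z : dot x (y - z) = dot x y - dot x z. Proof. by rewrite !dot2E; ring. Qed.
Lemma dotNr x y : dot x (- y) = - dot x y. Proof. by rewrite !dot2E; ring. Qed.
Lemma dotZr (k : R) x y : dot x (k *: y) = k * dot x y. Proof. by rewrite !dot2E; ring. Qed.
Lemma dotDl x y z : dot (y + z) x = dot y x + dot z x. Proof. by rewrite !dot2E; ring. Qed.
Lemma dotNl x y : dot (- y) x = - dot y x. Proof. by rewrite !dot2E; ring. Qed.
Lemma dotZl (k : R) x y : dot (k *: y) x = k * dot y x. Proof. by rewrite !dot2E; ring. Qed.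
Lemma dot_ge0 x : 0 <= dot x x. Proof. by rewrite dotE; nra. Qed.
Lemma dot_rot90 x : dot x (rot90 x) = 0. Proof. by rewrite !dot2E; ring. Qed.
Lemma dot_rot90K x y : dot (rot90 x) (rot90 y) = dot x y.
Proof. by rewrite !dot2E; ring. Qed.

Lemma enorm_ge0 x : 0 <= enorm x. Proof. exact: sqrtr_ge0. Qed.
Lemma enorm_sqr x : enorm x ^+ 2 = dot x x. Proof. by rewrite sqr_sqrtr// dot_ge0. Qed.
Lemma enormN x : enorm (- x) = enorm x.
Proof. by rewrite /enorm dotNr dotNl opprK. Qed.
Lemma enorm_le x (r : R) : 0 <= r -> dot x x <= r ^+ 2 -> enorm x <= r.
Proof. by move=> r0 h; rewrite -(ler_pXn2r (n := 2)) ?nnegrE ?enorm_ge0// enorm_sqr. Qed.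

Lemma ler_dot_enorm x y : `|dot x y| <= enorm x * enorm y.
Proof.
rewrite -(ler_pXn2r (n := 2)) ?nnegrE ?mulr_ge0 ?enorm_ge0// exprMn !enorm_sqr.
rewrite real_normK ?num_real//.
(* Lagrange's identity: the squared determinant is the defect in the Cauchy-Schwarz inequality. *)
have := sqr_ge0 (x 0 0 * y 0 1 - x 0 1 * y 0 0); rewrite !dotE => h; nra.
Qed.

Lemma ler_enormD x y : enorm (x + y) <= enorm x + enorm y.
Proof.
apply: enorm_le; first by rewrite addr_ge0 ?enorm_ge0.
have := ler_dot_enorm x y; rewrite ler_norml => /andP[_ h].
rewrite dotDr !dotDl (dotC y x) sqrrD !enorm_sqr; nra.
Qed.

Lemma ler_enormB x y z : enorm (x - z) <= enorm (x - y) + enorm (y - z).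
Proof. by rewrite (le_trans _ (ler_enormD _ _))// addrA subrK. Qed.

Lemma circle_dot u : circle u <-> dot u u = 1.
Proof.
split=> [h|h]; first by rewrite -enorm_sqr h expr1n.
by rewrite /circle/= /enorm h sqrtr1.
Qed.

Lemma circle_rot90 u : circle u -> circle (rot90 u).
Proof. by rewrite !circle_dot dot_rot90K. Qed.

Lemma circleN u : circle u -> circle (- u).
Proof. by rewrite !circle_dot dotNl dotNr opprK. Qed.

Lemma circle_dot_le u x : circle u -> `|dot u x| <= enorm x.
Proof. by move=> u1; rewrite (le_trans (ler_dot_enorm _ _))// u1 mul1r. Qed.

(** [u] and [rot90 u] form an orthonormal frame, in whose coordinates the later estimates are
    computed. *)
Lemma frameE u x : circle u -> x = dot u x *: u + dot (rot90 u) x *: rot90 u.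
Proof.
rewrite circle_dot dotE => u1; apply: rV2P; rewrite !dot2E.
- rewrite -[LHS]mul1r -u1; ring.
- rewrite -[LHS]mul1r -u1; ring.
Qed.

Lemma frame_inj u x y : circle u ->
  dot u x = dot u y -> dot (rot90 u) x = dot (rot90 u) y -> x = y.
Proof. by move=> u1 e1 e2; rewrite (frameE x u1) e1 e2 -frameE. Qed.

Lemma dot_frame u x y : circle u ->
  dot x y = dot u x * dot u y + dot (rot90 u) x * dot (rot90 u) y.
Proof.
by move=> u1; rewrite {1}(frameE y u1) dotDr !dotZr (dotC x) (dotC x) mulrC [X in _ + X]mulrC.
Qed.

Lemma enorm_frame_le u x : circle u -> enorm x <= `|dot u x| + `|dot (rot90 u) x|.
Proof.
move=> u1; apply: enorm_le; first by rewrite addr_ge0.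
rewrite (dot_frame _ _ u1) sqrrD.
by rewrite !real_normK ?num_real// -!expr2 lerD2r lerDl mulrn_wge0// mulr_ge0.
Qed.

Lemma dot_continuous u : continuous (dot u).
Proof.
rewrite (_ : dot u = (cst (u 0 0) \* (fun y => y 0 0)) + (cst (u 0 1) \* (fun y => y 0 1))); last first.
  by apply/funext => y; rewrite dotE.
move=> x; apply: continuousD.
  by apply: continuousM; [exact: cst_continuous|exact: coord_continuous].
by apply: continuousM; [exact: cst_continuous|exact: coord_continuous].
Qed.

Lemma enorm_continuous : continuous (@enorm R).
Proof.
have c : continuous (fun y : 'rV[R]_2 => dot y y).
  rewrite (_ : (fun y : 'rV[R]_2 => _) =
      ((fun y => y 0 0) \* (fun y => y 0 0)) + ((fun y => y 0 1) \* (fun y => y 0 1))); last first.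
    by apply/funext => y; rewrite dotE.
  move=> x; apply: continuousD.
    by apply: continuousM; exact: coord_continuous.
  by apply: continuousM; exact: coord_continuous.
have -> : @enorm R = Num.sqrt \o (fun y => dot y y) by [].
by move=> x; apply: continuous_comp; [exact: c|exact: sqrt_continuous].
Qed.

Lemma compact_dot_max K u : compact K -> K !=set0 ->
  exists2 p, K p & forall x, K x -> dot u x <= dot u p.
Proof.
move=> Kc K0; have [] := @compact_EVT_max _ R (dot u) K K0 Kc.
  by apply: continuous_subspaceT => x; exact: dot_continuous.
by move=> p; rewrite inE => Kp h; exists p => // x Kx; apply: h; rewrite inE.
Qed.

Lemma compact_enorm_bounded K : compact K -> exists2 r : R, 0 < r & forall x, K x -> enorm x <= r.
Proof.
move=> Kc; have [->|/set0P K0] := eqVneq K set0; first by exists 1.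
have [] := @compact_EVT_max _ R (@enorm R) K K0 Kc.
  by apply: continuous_subspaceT => x; exact: enorm_continuous.
move=> p; rewrite inE => Kp h; exists (enorm p + 1); first by rewrite ltr_wpDl ?enorm_ge0.
by move=> x Kx; rewrite (le_trans (h x _)) ?inE// lerDl.
Qed.

Lemma compact_closedT K : compact K -> closed K.
Proof. by apply: compact_closed; exact: norm_hausdorff. Qed.

Lemma closed_dot_eq u (c : R) : closed [set x | dot u x = c].
Proof.
apply: (@preimage_closed _ _ (dot u) [set y | y = c]) => [x _|]; last exact: closed_eq.
exact: dot_continuous.
Qed.

Lemma convex_seg K x y (s : R) : convex_set K -> K x -> K y -> 0 <= s <= 1 ->
  K (s *: x + (1 - s) *: y).
Proof.
move=> Kv Kx Ky /andP[s0 s1].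
have := Kv x y (Itv01 s0 s1); rewrite !inE => /(_ Kx Ky).
by [].
Qed.

End PlaneGeometry.

(** * Upper and lower bounds for one-dimensional Hausdorff measure *)

Section HausdorffMeasure.
Context {R : realType}.
Implicit Types (x y : 'rV[R]_2) (A B : set 'rV[R]_2).

Lemma diam_ge0 A : (0 <= diam A)%E.
Proof. by rewrite /diam le_max lexx. Qed.

Lemma diam_le A (r : R) : 0 <= r -> (forall x y, A x -> A y -> enorm (x - y) <= r) ->
  (diam A <= r%:E)%E.
Proof.
move=> r0 Ar; rewrite /diam ge_max lee_fin r0/=.
by apply: ge_ereal_sup => _ [x Ax [y Ay <-]]; rewrite lee_fin Ar.
Qed.

Lemma enorm_le_diam A x y : A x -> A y -> ((enorm (x - y))%:E <= diam A)%E.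
Proof.
move=> Ax Ay; rewrite /diam le_max; apply/orP; right.
by apply: ereal_sup_ubound; exists x => //; exists y.
Qed.

Lemma hausdorff1_pre_ge0 (delta : R) A : (0 <= hausdorff1_pre delta A)%E.
Proof.
apply: le_ereal_inf_tmp => _ [V _ <-].
by apply: nneseries_ge0 => n _ _; exact: diam_ge0.
Qed.

Lemma hausdorff1_ge0 A : (0 <= hausdorff1 A)%E.
Proof.
apply: (le_trans (hausdorff1_pre_ge0 1 A)).
by apply: ereal_sup_ubound; exists 1 => /=.
Qed.

Lemma le_hausdorff1 A B : A `<=` B -> (hausdorff1 A <= hausdorff1 B)%E.
Proof.
move=> AB; apply: ge_ereal_sup => _ [d d0 <-].
apply: (@le_trans _ _ (hausdorff1_pre d B)); last first.
  by apply: ereal_sup_ubound; exists d.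
apply: ereal_inf_le_tmp => _ [V [Vd BV] <-]; exists V => //; split=> //.
exact: subset_trans BV.
Qed.

(** Since [g] does not shrink distances on [A], pulling back a subdivision of [[0, M]] into short
    equal intervals covers [A] by pieces whose diameters add up to at most [M]. *)
Lemma hausdorff1_le A (g : 'rV[R]_2 -> R) (M : R) : 0 <= M ->
  (forall x, A x -> 0 <= g x <= M) ->
  (forall x y, A x -> A y -> enorm (x - y) <= `|g x - g y|) ->
  (hausdorff1 A <= M%:E)%E.
Proof.
move=> M0 gM Ag; apply: ge_ereal_sup => _ [d /= d0 <-].
pose m := (Num.truncn (M / d)).+1.
have m0 : (0 : R) < m%:R by rewrite ltr0n.
have md : M / m%:R <= d.
  by rewrite ler_pdivrMr// mulrC -ler_pdivrMr// ltW// /m; apply: truncnS_gt.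
pose V i : set 'rV[R]_2 := if (i < m)%N then
  [set x | A x /\ (i%:R * (M / m%:R) <= g x <= (i.+1%:R) * (M / m%:R))] else set0.
have Vdiam i : (diam (V i) <= (if (i < m)%N then M / m%:R else 0)%:E)%E.
  rewrite /V; case: ifPn => im; last by apply: diam_le => // x y [].
  apply: diam_le; first by rewrite divr_ge0// ltW.
  move=> x y /= [Ax gx] [Ay gy]; apply: (le_trans (Ag _ _ Ax Ay)).
  move: gx gy; rewrite -natr1 mulrDl mul1r; set k := i%:R * _; set e := M / _.
  by move=> /andP[? ?] /andP[? ?]; rewrite ler_norml; apply/andP; split; lra.
apply: (@le_trans _ _ (\sum_(0 <= i <oo) diam (V i))%E).
  apply: ereal_inf_lbound; exists V => //; split=> [i|x Ax].
    apply: (le_trans (Vdiam i)); rewrite lee_fin; case: ifP => // _; exact: ltW.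
  have /andP[gx0 gxM] := gM _ Ax.
  have [gxltM|gxgeM] := ltP (g x) M.
    have Mp : 0 < M by lra.
    have e0 : 0 < M / m%:R by rewrite divr_gt0.
    exists (Num.truncn (g x / (M / m%:R))) => //=.
    have h0 : 0 <= g x / (M / m%:R) by rewrite divr_ge0// ltW.
    have /andP[h1 h2] := truncn_itv h0.
    rewrite /V ifT/=; last first.
      rewrite -(ltr_nat R) (le_lt_trans h1)// ltr_pdivrMr// mulrCA divff ?mulr1//.
      by rewrite gt_eqF.
    split=> //; apply/andP; split; first by rewrite -ler_pdivlMr.
    by rewrite -ler_pdivrMr// ltW.
  (* The value [M] is the right end of the last closed interval. This case also covers [M = 0],
     where all the intervals degenerate. *)
  have gxE : g x = M by apply/eqP; rewrite eq_le gxM.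
  exists m.-1 => //; rewrite /V /= ltnSn; split=> //; rewrite gxE.
  rewrite [X in _ && (_ <= X)]mulrCA divff ?gt_eqF// mulr1 lexx andbT.
  by rewrite mulrA ler_pdivrMr// mulrC ler_wpM2l// ler_nat leqnSn.
apply: (@le_trans _ _ (\sum_(0 <= i <oo) (if (i < m)%N then M / m%:R else 0)%:E)%E).
  by apply: lee_nneseries => [i _ _|n _]; [exact: diam_ge0|exact: Vdiam].
rewrite (@nneseries_split _ _ 0 m); last first.
  by move=> k _; rewrite lee_fin; case: ifP => // _; rewrite divr_ge0// ltW.
rewrite add0n [X in (_ + X)%E]eseries0 ?adde0; last first.
  by move=> i mi _; rewrite ltnNge mi.
rewrite sumEFin big_nat (eq_bigr (fun=> M / m%:R)); last by move=> i /= ->.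
by rewrite -big_nat sumr_const_nat subn0 -(mulr_natr (M / _)) divfK ?gt_eqF.
Qed.

(** A 1-Lipschitz map does not increase diameters, so every cover of [A] gives a cover of []a, b[]
    by intervals with the same lengths; countable subadditivity of Lebesgue measure concludes. *)
Lemma hausdorff1_ge A (g : 'rV[R]_2 -> R) (a b : R) : a <= b ->
  (forall x y, `|g x - g y| <= enorm (x - y)) ->
  (forall t, a < t < b -> exists2 x, A x & g x = t) ->
  ((b - a)%:E <= hausdorff1 A)%E.
Proof.
move=> ab glip gA.
(* A single scale suffices for a lower bound; the scale 1 serves to make all diameters finite. *)
apply: (@le_trans _ _ (hausdorff1_pre 1 A)); last first.
  by apply: ereal_sup_ubound; exists 1 => /=.
apply: le_ereal_inf_tmp => _ [V [V1 AV] <-].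
have Vfin i : diam (V i) \is a fin_num.
  by rewrite ge0_fin_numE ?diam_ge0// (le_lt_trans (V1 i))// ltry.
pose d i := fine (diam (V i)).
have dE i : diam (V i) = (d i)%:E by rewrite /d fineK.
have d0 i : 0 <= d i by rewrite -lee_fin -dE diam_ge0.
have gd i x y : V i x -> V i y -> g x <= g y + d i.
  move=> Vx Vy; have := enorm_le_diam Vx Vy; rewrite dE lee_fin.
  by have := glip x y; rewrite ler_norml => /andP[_]; lra.
(* For an empty [V i] the supremum is a default value, which is harmless: the interval has length
   [d i] in any case. *)
pose I i : set R := let s := sup [set g x | x in V i] in `[s - d i, s]%classic.
have VI i x : V i x -> I i (g x).
  move=> Vx; have gs : has_sup [set g x | x in V i].
    split; first by exists (g x), x.
    by exists (g x + d i) => _ [y Vy <-]; exact: gd.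
  rewrite /I /= in_itv /=; apply/andP; split; last first.
    by apply: (sup_upper_bound gs); exists x.
  rewrite lerBlDr; apply: ge_sup; first by exists (g x), x.
  by move=> _ [y Vy <-]; exact: gd.
have muI i : lebesgue_measure (I i) = (d i)%:E.
  rewrite /I /= lebesgue_measure_itv /= lte_fin.
  case: ltP => h; first by rewrite -EFinB; congr EFin; ring.
  by have -> : d i = 0; [move: (d0 i) h; lra|].
have sub : `]a, b[%classic `<=` \bigcup_i I i.
  move=> t /=; rewrite in_itv /= => /gA[x /AV[i _ Vx] <-].
  by exists i => //; exact: VI.
have -> : (b - a)%:E = lebesgue_measure (`]a, b[%classic : set R).
  rewrite lebesgue_measure_itv /= lte_fin; case: ltP => h; first by rewrite -EFinB.
  by congr EFin; lra.
have mI i : measurable (I i : set (measurableTypeR R)) by exact: measurable_itv.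
have mab : measurable (`]a, b[%classic : set (measurableTypeR R)) by exact: measurable_itv.
have h := @measure_sigma_subadditive _ _ _ (@lebesgue_measure R) _ I mI mab sub.
apply: (le_trans h); apply: lee_nneseries => [i _ _|i _]; first exact: measure_ge0.
by rewrite dE -muI.
Qed.

End HausdorffMeasure.

(** * Finiteness of surface area measures *)

Section Rectifiable.
Context {R : realType}.
Implicit Types (x y u w : 'rV[R]_2) (A B C D K sigma : set 'rV[R]_2).

(** On its image [g] has a 1-Lipschitz inverse, so [A] is a Lipschitz image of a bounded set of
    reals. These are the hypotheses of [hausdorff1_le]. *)
Definition expansive_chart A (g : 'rV[R]_2 -> R) (M : R) : Prop :=
  [/\ 0 <= M, forall x, A x -> 0 <= g x <= M
    & forall x y, A x -> A y -> enorm (x - y) <= `|g x - g y|].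

Definition rectifiable A : Prop := exists g M, expansive_chart A g M.

Lemma rectifiable_hausdorff1_fin A : rectifiable A -> hausdorff1 A \is a fin_num.
Proof.
move=> [g [M [M0 gM Ag]]]; rewrite ge0_fin_numE ?hausdorff1_ge0//.
exact: le_lt_trans (hausdorff1_le M0 gM Ag) (ltry _).
Qed.

Lemma sub_rectifiable A B : A `<=` B -> rectifiable B -> rectifiable A.
Proof.
by move=> AB [g [M [M0 gM Ag]]]; exists g, M; split => // [x /AB|x y /AB Bx /AB By];
  [exact: gM|exact: Ag].
Qed.

(** The chart of the second set is shifted past the range of the first by a gap [r + r], which
    exceeds any distance between two points of the union. *)
Lemma rectifiableU (r : R) A B : 0 <= r -> (forall x, (A `|` B) x -> enorm x <= r) ->
  rectifiable A -> rectifiable B -> rectifiable (A `|` B).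
Proof.
move=> r0 ABr [g [M [M0 gM Ag]]] [h [N [N0 hN Bh]]].
have far x y : (A `|` B) x -> (A `|` B) y -> enorm (x - y) <= r + r.
  move=> /ABr xr /ABr yr; rewrite (le_trans (ler_enormD _ _))// enormN lerD//.
exists (fun x => if pselect (A x) then g x else h x + M + r + r), (M + N + r + r).
split=> [|x|x y ABx ABy]; first by rewrite !addr_ge0.
- case: pselect => /= [Ax _|nAx [//|Bx]].
    by have /andP[? ?] := gM _ Ax; apply/andP; split; lra.
  by have /andP[? ?] := hN _ Bx; apply/andP; split; lra.
- have xy := far _ _ ABx ABy.
  case: pselect => /= Ax; case: pselect => /= Ay.
  + exact: Ag.
  + case: ABy => // By; have /andP[? ?] := gM _ Ax; have /andP[? ?] := hN _ By.
    by rewrite distrC ger0_norm; lra.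
  + case: ABx => // Bx; have /andP[? ?] := gM _ Ay; have /andP[? ?] := hN _ Bx.
    by rewrite ger0_norm; lra.
  + case: ABx => // Bx; case: ABy => // By; apply: (le_trans (Bh _ _ Bx By)).
    by rewrite le_eqVlt; apply/orP; left; apply/eqP; congr (`| _ |); ring.
Qed.

Definition supported_in_quadrant A u x : Prop :=
  exists w, [/\ circle w, 0 <= dot u w, 0 <= dot (rot90 u) w
    & forall y, A y -> dot w y <= dot w x].

(* The displacement between two points with normals in the same quadrant has
   coordinates of opposite signs in the frame of that quadrant. *)
Lemma rectifiable_quadrant (r : R) A u : 0 <= r -> circle u ->
  (forall x, A x -> enorm x <= r) -> (forall x, A x -> supported_in_quadrant A u x) ->
  rectifiable A.
Proof.
move=> r0 u1 Ar AN.
have v1 := circle_rot90 u1.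
exists (fun x => dot (rot90 u) x - dot u x + (r + r)), (r + r + (r + r)).
split=> [|x Ax|x y Ax Ay]; first by rewrite !addr_ge0.
- have := le_trans (circle_dot_le x u1) (Ar _ Ax); rewrite ler_norml => /andP[? ?].
  have := le_trans (circle_dot_le x v1) (Ar _ Ax); rewrite ler_norml => /andP[? ?].
  by apply/andP; split; lra.
apply: (le_trans (enorm_frame_le _ u1)).
have [w [w1 wu wv /(_ _ Ay) wx]] := AN x Ax.
have [w' [w1' wu' wv' /(_ _ Ax) wy]] := AN y Ay.
have -> : dot (rot90 u) x - dot u x + (r + r) - (dot (rot90 u) y - dot u y + (r + r)) =
  dot (rot90 u) (x - y) - dot u (x - y) by rewrite !dotBr; ring.
have wx2 : 0 <= dot w (x - y) by rewrite dotBr subr_ge0.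
have wy2 : dot w' (x - y) <= 0 by rewrite dotBr subr_le0.
move: w1 w1' wx2 wy2; rewrite !circle_dot (dot_frame w w u1) (dot_frame w' w' u1).
rewrite (dot_frame w _ u1) (dot_frame w' _ u1).
move: wu wv wu' wv'; set a := dot u w; set b := dot _ w; set a' := dot u w'; set b' := dot _ w'.
set s := dot u _; set t := dot _ (x - y) => a0 b0 a0' b0' ab ab' h h'.
clear wx wy.
have pos (c d p q : R) : 0 <= c -> 0 <= d -> c * c + d * d = 1 -> 0 < p -> 0 < q ->
    0 < c * p + d * q.
  move=> c0 d0 cd p0 q0.
  have [cp|cz] := ltP 0 c; first by rewrite ltr_pwDl ?mulr_gt0 ?mulr_ge0// ltW.
  have ce : c = 0 by lra.
  have dp : 0 < d by nra.
  by rewrite ce mul0r add0r mulr_gt0.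
(* If [s] and [t] had the same strict sign, one of the two supporting inequalities would fail.
   Otherwise the sum of their absolute values is that of [t - s]. *)
have [s0|s0] := leP 0 s; have [t0|t0] := leP 0 t.
- have [sp|sz] := ltP 0 s; have [tp|tz] := ltP 0 t.
  + by exfalso; move: (pos _ _ _ _ a0' b0' ab' sp tp); clear -h' => ?; lra.
  + have -> : t = 0 by lra.
    by rewrite normr0 addr0 sub0r normrN.
  + have -> : s = 0 by lra.
    by rewrite normr0 add0r subr0.
  + have -> : s = 0 by lra.
    by rewrite normr0 add0r subr0.
- by rewrite (ltr0_norm t0) (ger0_norm s0) distrC ger0_norm; lra.
- by rewrite (ltr0_norm s0) (ger0_norm t0) ger0_norm; lra.
- have ns : 0 < - s by lra.
  have nt : 0 < - t by lra.
  by exfalso; move: (pos _ _ _ _ a0 b0 ab ns nt); clear -h => ?; lra.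
Qed.

Definition self_supported A : Prop :=
  forall x, A x -> exists2 w, circle w & forall y, A y -> dot w y <= dot w x.

(** Sorting the points by the quadrant of a supporting direction splits [A] into four pieces covered
    by [rectifiable_quadrant]. *)
Lemma rectifiable_self_supported (r : R) A : 0 <= r -> (forall x, A x -> enorm x <= r) ->
  self_supported A -> rectifiable A.
Proof.
move=> r0 Ar AN.
pose e : 'rV[R]_2 := \row_(i < 2) (i == 0)%:R.
have e1 : circle e by rewrite circle_dot !dot2E /= mulr0 mulr1 addr0.
have f1 := circle_rot90 e1.
pose Q u := [set x | A x /\ supported_in_quadrant A u x].
have Qrect u : circle u -> rectifiable (Q u).
  move=> u1; apply: (@rectifiable_quadrant r _ u) => // x [Ax]; first by move=> _; exact: Ar.
  by move=> [w [w1 wu wv wx]]; exists w; split => // y [Ay _]; exact: wx.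
apply: (@sub_rectifiable _ ((Q e `|` Q (rot90 e)) `|` (Q (- e) `|` Q (- rot90 e)))).
  move=> x Ax; have [w w1 wx] := AN x Ax.
  have jj : dot (rot90 (rot90 e)) w = - dot e w by rewrite !dot2E; ring.
  have jn : dot (rot90 (- e)) w = - dot (rot90 e) w by rewrite !dot2E; ring.
  have jjn : dot (rot90 (- rot90 e)) w = dot e w by rewrite !dot2E; ring.
  have [a|/ltW a] := leP 0 (dot e w); have [b|/ltW b] := leP 0 (dot (rot90 e) w).
  - by left; left; split=> //; exists w.
  - by right; right; split=> //; exists w; split=> //; rewrite ?jjn// dotNl oppr_ge0.
  - by left; right; split=> //; exists w; split=> //; rewrite jj oppr_ge0.
  - by right; left; split=> //; exists w; split=> //; rewrite ?jn ?dotNl oppr_ge0.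
have bd : forall u v x, (Q u `|` Q v) x -> enorm x <= r by move=> u v x [] [/Ar].
apply: (rectifiableU r0) => [x [/bd//|/bd//]| |].
- by apply: (rectifiableU r0); [exact: bd|exact: Qrect|exact: Qrect].
- by apply: (rectifiableU r0); [exact: bd|apply: Qrect; exact: circleN|apply: Qrect; exact: circleN].
Qed.

(** The circle is supported at [x] in the direction [x]. This finite length later turns the bound
    relative to [hausdorff1 sigma] into a uniform one. *)
Lemma hausdorff1_circle_fin : hausdorff1 (@circle R) \is a fin_num.
Proof.
apply: rectifiable_hausdorff1_fin; apply: (@rectifiable_self_supported 1) => //.
  by move=> x ->.
move=> x x1; exists x => // y y1; move/circle_dot : (x1) => ->.
by have := circle_dot_le y x1; rewrite y1 ler_norml => /andP[].
Qed.

Lemma boundary_sub K : compact K -> boundary K `<=` K.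
Proof. by move=> Kc x [+ _]; exact: compact_closedT. Qed.

(** Each point of the normal preimage is supported by its own outer normal. Finiteness allows
    differences of measures to be computed in [R]. *)
Lemma area_measure_fin K sigma : compact K -> area_measure K sigma \is a fin_num.
Proof.
move=> Kc; apply: rectifiable_hausdorff1_fin.
have [r r0 Kr] := compact_enorm_bounded Kc.
apply: (@rectifiable_self_supported r); first exact: ltW.
  by move=> x [/(boundary_sub Kc) /Kr].
move=> x [bx [u su [u1 ux]]]; exists u => // y [/(boundary_sub Kc) Ky _].
exact: ux.
Qed.

End Rectifiable.

(** * Boundary length over a small arc of normals *)

Section Arc.
Context {R : realType}.
Implicit Types (x y p q u w : 'rV[R]_2) (K : set 'rV[R]_2) (k : R).

(* The arc of unit vectors whose angle from [u] lies in [0, arctan k). *)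
Definition arc u k : set 'rV[R]_2 :=
  [set w | [/\ circle w, 0 <= dot (rot90 u) w & dot (rot90 u) w < k * dot u w]].

(* [x] is the clockwise-most point of the face of [K] with outer normal
   [u + k *: rot90 u]. *)
Definition first_point K u k x : Prop :=
  [/\ K x, forall y, K y -> dot u y + k * dot (rot90 u) y <= dot u x + k * dot (rot90 u) x
    & forall y, K y -> dot u y + k * dot (rot90 u) y = dot u x + k * dot (rot90 u) x ->
      dot (rot90 u) x <= dot (rot90 u) y].

Lemma interior_nonempty K : interior K !=set0 -> K !=set0.
Proof. by move=> [x /interior_subset]; exists x. Qed.

(** From an interior point a small step along [w] would stay in [K] and increase [dot w]. *)
Lemma not_interior_extreme K w x : circle w -> (forall y, K y -> dot w y <= dot w x) ->
  ~ interior K x.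
Proof.
move=> w1 wx Kx.
have c : {for 0, continuous (fun s : R => x + s *: w)}.
  by apply: continuousD; [exact: cst_continuous|exact: scalel_continuous].
have : nbhs (0 : R) [set s : R | K (x + s *: w)].
  by apply: c; rewrite scale0r addr0.
move=> /nbhs_ballP[e /= e0 he].
have := he (e / 2) => /=; rewrite /ball /= sub0r normrN gtr0_norm ?divr_gt0//.
move=> /(_ _)/wx; rewrite dotDr dotZr; move/circle_dot : w1 => ->.
by rewrite mulr1 gerDl leNgt divr_gt0// => h; have : false by apply: h; lra.
Qed.

(** Each endpoint is compared with the other in its own maximising direction: the chord advances
    along [rot90 u] and descends with slope at most [k]. *)
Lemma first_point_chord K u k p q : first_point K u 0 p -> first_point K u k q -> 0 < k ->
  [/\ 0 <= dot (rot90 u) (q - p), dot u (q - p) <= 0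
    & - (k * dot (rot90 u) (q - p)) <= dot u (q - p)].
Proof.
move=> [Kp pmax _] [Kq qmax _] k0.
have := pmax _ Kq; have := qmax _ Kp; rewrite !mul0r !addr0 !dotBr mulrBr => h1 h2.
by split; [rewrite -(pmulr_rge0 _ k0) mulrBr; lra|lra|lra].
Qed.

(** In the frame of [u], the points with normals in the arc form a decreasing graph of slope at most
    [k] lying over the chord, so the coordinate along [rot90 u], stretched by [1 + k], is an
    expansive chart. *)
Lemma area_measure_arc_le K u k p q : compact K -> circle u -> 0 < k ->
  first_point K u 0 p -> first_point K u k q ->
  (area_measure K (arc u k) <= ((1 + k) * dot (rot90 u) (q - p))%:E)%E.
Proof.
move=> Kc u1 k0 fp fq; have [D0 e0 kDe] := first_point_chord fp fq k0.
case: fp fq => [Kp pmax pfirst] [Kq qmax _].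
have k1 : 0 < 1 + k by lra.
apply: (@hausdorff1_le _ _ (fun x => (1 + k) * dot (rot90 u) (x - p))).
- by rewrite mulr_ge0// ltW.
- move=> x [/(boundary_sub Kc) Kx [w [w1 wv wu] [_ wmax]]].
  have := wmax _ Kp; have := wmax _ Kq; have := pmax _ Kx; have := qmax _ Kx.
  rewrite !mul0r !addr0 !(dot_frame w _ u1) !dotBr.
  have pf := pfirst _ Kx; rewrite !mul0r !addr0 in pf.
  move: wu wv pf {wmax pmax qmax}.
  set a := dot u w; set b := dot _ w.
  set xu := dot u x; set xv := dot _ x; set pu := dot u p; set pv := dot _ p.
  set qu := dot u q; set qv := dot _ q => ba b0 pf h1 h2 h3 h4.
  have a0 : 0 < a by nra.
  (* If the normal [w] is not [u], its supporting inequality gives this; if it is [u], then [x] lies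
     on the face of [p] and the choice of [p] as first point decides. *)
  have h5 : pv <= xv.
    have [bp|bz] := ltP 0 b; first by rewrite -(ler_pM2l bp); nra.
    have be : b = 0 by lra.
    by apply: pf; apply/eqP; rewrite eq_le h2/= -(ler_pM2l a0); nra.
  have h6 : xv <= qv.
    have kab : 0 < k * a - b by lra.
    rewrite -(ler_pM2l kab); nra.
  apply/andP; split; first by rewrite mulr_ge0 ?(ltW k1)// subr_ge0.
  by rewrite ler_pM2l// lerD2r.
- move=> x y [/(boundary_sub Kc) Kx [w [w1 wv wu] [_ wmax]]].
  move=> [/(boundary_sub Kc) Ky [w' [w1' wv' wu'] [_ wmax']]].
  have := wmax _ Ky; have := wmax' _ Kx.
  rewrite -mulrBr normrM (gtr0_norm k1) -dotBr opprB addrA subrK.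
  have -> : dot w' x <= dot w' y = (dot w' (x - y) <= 0) by rewrite dotBr subr_le0.
  have -> : dot w y <= dot w x = (0 <= dot w (x - y)) by rewrite dotBr subr_ge0.
  rewrite (dot_frame w' _ u1) (dot_frame w _ u1) => h1 h2; apply: (le_trans (enorm_frame_le _ u1)).
  rewrite mulrDl mul1r [leLHS]addrC lerD2l.
  move: h1 h2 wv wu wv' wu'.
  set a := dot u w; set b := dot _ w; set a' := dot u w'; set b' := dot _ w'.
  set s := dot u _; set t := dot _ (x - y) => h1 h2 b0 ba b0' ba'.
  have a0 : 0 < a by nra.
  have a0' : 0 < a' by nra.
  (* One normal forces [s] and [t] to have opposite signs, the other bounds the absolute value of
     [s] by [k] times that of [t]. *)
  have [t0|/ltW t0] := leP 0 t.
  + have bt := mulr_ge0 b0' t0; have kbt := ler_wpM2r t0 (ltW ba).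
    have s0 : s <= 0 by rewrite -(ler_pM2l a0'); lra.
    by rewrite (ler0_norm s0) (ger0_norm t0) -(ler_pM2l a0); lra.
  + have bt := mulr_ge0_le0 b0 t0; have kbt := ler_wnM2r t0 (ltW ba').
    have s0 : 0 <= s by rewrite -(ler_pM2l a0); lra.
    by rewrite (ger0_norm s0) (ler0_norm t0) -(ler_pM2l a0'); lra.
Qed.

(** Projection onto [rot90 u] is 1-Lipschitz, so it suffices to find, over every interior point of
    the projected chord, a boundary point with a normal in the arc. It is the topmost point of [K]
    on the corresponding line. *)
Lemma le_area_measure_arc K u k p q : compact K -> convex_set K -> circle u -> 0 < k ->
  first_point K u 0 p -> first_point K u k q ->
  ((dot (rot90 u) (q - p))%:E <= area_measure K (arc u k))%E.
Proof.
move=> Kc Kv u1 k0 fp fq; have [D0 e0 kDe] := first_point_chord fp fq k0.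
case: fp fq => [Kp pmax _] [Kq qmax qfirst].
rewrite dotBr; apply: (@hausdorff1_ge _ _ (dot (rot90 u))).
- by rewrite -subr_ge0 -dotBr.
- by move=> x y; rewrite -dotBr; apply: circle_dot_le; exact: circle_rot90.
move=> t /andP[pt tq].
set v := rot90 u in pt tq *.
have slice y z : K y -> K z -> dot v y < t < dot v z ->
    exists2 x, K x & dot v x = t /\ (dot v z - dot v y) * dot u x =
      (dot v z - t) * dot u y + (t - dot v y) * dot u z.
  move=> Ky Kz /andP[yt tz]; have yz : 0 < dot v z - dot v y by lra.
  exists (((dot v z - t) / (dot v z - dot v y)) *: y +
    (1 - (dot v z - t) / (dot v z - dot v y)) *: z).
    apply: convex_seg => //; apply/andP; split; first by rewrite divr_ge0; lra.
    by rewrite ler_pdivrMr//; lra.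
  by rewrite !dotDr !dotZr; split; field; lra.
have [x [Kx xt] xmax] : exists2 x, (K `&` [set x | dot v x = t]) x &
    forall y, (K `&` [set x | dot v x = t]) y -> dot u y <= dot u x.
  apply: compact_dot_max.
    by apply: compact_closedI => //; exact: closed_dot_eq.
  by have [|x Kx [xt _]] := slice _ _ Kp Kq; [rewrite pt|exists x].
have above y z : K y -> K z -> dot v y < t < dot v z ->
    (dot v z - t) * dot u y + (t - dot v y) * dot u z <= (dot v z - dot v y) * dot u x.
  move=> Ky Kz /[dup] /andP[yt tz] /(slice _ _ Ky Kz)[x' Kx' [x't <-]].
  by apply: ler_wpM2l; [lra|apply: xmax].
(* By convexity, slopes from [x] to points on its right never exceed slopes to points on its left.
   The supremum of the former is therefore the slope of a supporting line at [x]. *)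
pose slope z := (dot u z - dot u x) / (dot v z - t).
pose S := [set slope z | z in [set z | K z /\ t < dot v z]].
have slopes y z : K y -> K z -> dot v y < t -> t < dot v z ->
    slope z * (t - dot v y) <= dot u x - dot u y.
  move=> Ky Kz yt tz; have := above _ _ Ky Kz; rewrite yt tz => /(_ isT) h.
  by rewrite /slope mulrAC ler_pdivrMr; lra.
have hS : has_sup S.
  split; first by exists (slope q), q.
  exists ((dot u x - dot u p) / (t - dot v p)) => _ [z [Kz tz] <-].
  by rewrite ler_pdivlMr ?subr_gt0//; exact: slopes.
have mR y : K y -> dot v y < t -> sup S * (t - dot v y) <= dot u x - dot u y.
  move=> Ky yt; rewrite -ler_pdivlMr ?subr_gt0//; apply: ge_sup; first by exists (slope q), q.
  by move=> _ [z [Kz tz] <-]; rewrite ler_pdivlMr ?subr_gt0//; exact: slopes.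
have mL z : K z -> t < dot v z -> dot u z - dot u x <= sup S * (dot v z - t).
  move=> Kz tz; rewrite -ler_pdivrMr ?subr_gt0//; apply: (sup_upper_bound hS).
  by exists z.
set m := sup S in mR mL.
have support y : K y -> dot u y - m * dot v y <= dot u x - m * t.
  move=> Ky; have [yt|ty|yt] := ltgtP (dot v y) t.
  - by have := mR _ Ky yt; lra.
  - by have := mL _ Ky ty; lra.
  - by rewrite yt lerD2r; apply: xmax.
have m0 : m <= 0.
  have := mR _ Kp pt; have := pmax _ Kx; rewrite !mul0r !addr0 => h1 h2.
  have h3 : 0 < t - dot v p by lra.
  by rewrite -(ler_pM2r h3); lra.
(* Strict because [q] is the first point of its face and [x] comes before it; this matches the open
   end of the arc. *)
have km : - k < m.
  have xq : dot u x + k * t < dot u q + k * dot v q.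
    rewrite lt_neqAle; apply/andP; split; last by rewrite -xt; exact: qmax.
    by apply/eqP => h; have := qfirst _ Kx; rewrite -/v xt h => /(_ erefl); lra.
  have := mL _ Kq tq => h; have tq' : 0 < dot v q - t by lra.
  by rewrite -(ltr_pM2r tq'); lra.
have n0 : 0 < 1 + m ^+ 2 by rewrite ltr_pwDl// sqr_ge0.
pose n := Num.sqrt (1 + m ^+ 2).
have np : 0 < n by rewrite sqrtr_gt0.
pose w := n^-1 *: (u - m *: v).
have uu : dot u u = 1 by exact/circle_dot.
have vv : dot v v = 1 by exact/circle_dot/circle_rot90.
have uv : dot u v = 0 by exact: dot_rot90.
have wu : dot u w = n^-1 by rewrite /w dotZr dotBr dotZr uu uv mulr0 subr0 mulr1.
have wv : dot v w = - m / n by rewrite /w dotZr dotBr dotZr vv dotC uv sub0r mulr1 mulrC.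
have w1 : circle w.
  rewrite circle_dot (dot_frame _ _ u1) wu wv.
  have -> : n^-1 * n^-1 + - m / n * (- m / n) = (1 + m ^+ 2) / n ^+ 2 by field; lra.
  by rewrite sqr_sqrtr ?divff// ?gt_eqF// ltW.
have wmax y : K y -> dot w y <= dot w x.
  move=> /support h; rewrite /w !dotZl ler_pM2l ?invr_gt0// !dotDl !dotNl !dotZl xt; lra.
exists x => //; split.
  split; first exact: subset_closure.
  exact: not_interior_extreme w1 wmax.
exists w; last by [].
split=> //; rewrite -/v wv ?wu; first by rewrite divr_ge0 ?oppr_ge0// ltW.
by rewrite ltr_pM2r ?invr_gt0//; lra.
Qed.

Lemma arc_borel u k : circle_borel (arc u k).
Proof.
split; last by move=> w [].
have mO (A : set 'rV[R]_2) : open A -> <<s (open : set (set 'rV[R]_2)) >> A.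
  exact: sub_sigma_algebra.
pose T := g_sigma_algebraType (open : set (set 'rV[R]_2)).
have mC (A : set T) : measurable A -> measurable (~` A) by exact: measurableC.
have mc (c : R) (f : 'rV[R]_2 -> R) : continuous f ->
    @measurable _ T [set w | f w < c].
  move=> fc; apply: mO; rewrite (_ : [set w | _] = f @^-1` [set r | r < c])//.
  by apply: open_comp; [move=> x _; exact: fc|exact: open_lt].
(* Each closed condition is the complement of an open one, and norm 1 is the conjunction of two such
   conditions. *)
have : @measurable _ T ((~` [set w | enorm w < 1] `&` ~` [set w | - enorm w < - 1]) `&`
   (~` [set w | dot (rot90 u) w < 0] `&` [set w | dot (rot90 u - k *: u) w < 0])).
  apply: measurableI; apply: measurableI; try apply: mC; apply: mc.
  - exact: enorm_continuous.
  - by move=> x; apply: continuousN; exact: enorm_continuous.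
  - exact: dot_continuous.
  - exact: dot_continuous.
rewrite /measurable /=; congr (smallest _ _ _); apply/seteqP; split=> w /=.
- move=> [[/negP h1 /negP h2] [/negP h3 h4]]; split.
  + by apply/eqP; rewrite eq_le; move: h1 h2; rewrite -!leNgt lerN2 => -> ->.
  + by rewrite leNgt.
  + by move: h4; rewrite dotDl dotNl dotZl subr_lt0.
- move=> [h1 h2 h3]; rewrite h1 !ltxx dotDl dotNl dotZl subr_lt0; do !split => //.
  by apply/negP; rewrite -leNgt.
Qed.

End Arc.

(** * Chains of chords along a quarter turn *)

Section Chain.
Context {R : realType}.
Implicit Types (x y z p q u w a : 'rV[R]_2) (C D K : set 'rV[R]_2) (k : R).

Lemma rot90K x : rot90 (rot90 x) = - x.
Proof. by apply: rV2P; rewrite !dot2E. Qed.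

(** Two successive maximisations: [dot u] on [K], then [- rot90 u] on the resulting compact face. *)
Lemma first_point_exists K u : compact K -> K !=set0 -> exists p, first_point K u 0 p.
Proof.
move=> Kc K0; have [m Km mmax] := compact_dot_max u Kc K0.
have [p [Kp pm] pmax] : exists2 p, (K `&` [set x | dot u x = dot u m]) p &
    forall y, (K `&` [set x | dot u x = dot u m]) y ->
      dot (- rot90 u) y <= dot (- rot90 u) p.
  apply: compact_dot_max; last by exists m.
  by apply: compact_closedI => //; exact: closed_dot_eq.
exists p; split=> // [y|y]; rewrite !mul0r !addr0 pm; first exact: mmax.
by move=> Ky yp; have := pmax y (conj Ky yp); rewrite !dotNl lerN2.
Qed.

Lemma first_point_unique K u p q : circle u -> first_point K u 0 p -> first_point K u 0 q ->
  p = q.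
Proof.
move=> u1 [Kp pm pf] [Kq qm qf].
move: pm pf qm qf; rewrite !mul0r !addr0.
move=> /(_ _ Kq); rewrite mul0r addr0 => pm /(_ _ Kq); rewrite mul0r addr0 => pf.
move=> /(_ _ Kp); rewrite mul0r addr0 => qm /(_ _ Kp); rewrite mul0r addr0 => qf.
have e : dot u p = dot u q by apply/eqP; rewrite eq_le qm pm.
by apply: (frame_inj u1 e); apply/eqP; rewrite eq_le pf// qf.
Qed.

(** This is p_K(u). The default value 0 never occurs for nonempty compact [K]. *)
Definition face_point K u : 'rV[R]_2 := xget 0 (first_point K u 0).

Lemma face_pointP K u : compact K -> K !=set0 -> first_point K u 0 (face_point K u).
Proof. by move=> Kc K0; apply: xgetPex; exact: first_point_exists. Qed.

(** Negation is a half turn: it preserves the counterclockwise order that selects the first point of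
    a face. *)
Lemma face_pointN K u : compact K -> K !=set0 -> origin_symmetric K -> circle u ->
  face_point K (- u) = - face_point K u.
Proof.
move=> Kc K0 Ks u1.
have KN x : K x -> K (- x) by move=> Kx; rewrite -Ks; exists x.
apply: (first_point_unique (circleN u1) (face_pointP _ Kc K0)).
have [Kp pm pf] := face_pointP u Kc K0.
have JN : rot90 (- u) = - rot90 u by apply: rV2P; rewrite !dot2E.
split; first exact: KN.
  move=> y Ky; have := pm _ (KN _ Ky); rewrite !mul0r !addr0.
  by rewrite !dotNl !dotNr opprK.
move=> y Ky; have := pf _ (KN _ Ky); rewrite !mul0r !addr0 JN.
by rewrite !dotNl !dotNr !opprK => h e; apply: h; rewrite -e.
Qed.

(* Turning [u] by the angle with cosine [c] and sine [s] gives a positive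
   multiple of [u + (s / c) *: rot90 u]. *)
Lemma first_point_rot K u (c s : R) q : circle u -> 0 < c -> 0 <= s ->
  first_point K (c *: u + s *: rot90 u) 0 q -> first_point K u (s / c) q.
Proof.
move=> u1 c0 s0 [Kq qm qf].
have J : rot90 (c *: u + s *: rot90 u) = c *: rot90 u - s *: u.
  by apply: rV2P; rewrite !dot2E; ring.
have E y : dot (c *: u + s *: rot90 u) y = c * (dot u y + s / c * dot (rot90 u) y).
  by rewrite dotDl !dotZl; field; lra.
split=> // y Ky.
  by have := qm _ Ky; rewrite !mul0r !addr0 !E ler_pM2l.
move=> e; have := qf _ Ky; rewrite !mul0r !addr0 !E e J => /(_ erefl).
rewrite !dotDl !dotNl !dotZl.
have -> : dot u y = dot u q + s / c * dot (rot90 u) q - s / c * dot (rot90 u) y by lra.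
rewrite -subr_ge0 => h.
(* Once [dot u y] is eliminated by the tie, the order along the rotated face is the order along
   [rot90 u] up to this positive factor. *)
have cs : 0 < c + s * (s / c) by rewrite ltr_pwDl// mulr_ge0// divr_ge0// ltW.
rewrite -subr_ge0 -(pmulr_rge0 _ cs); apply: (le_trans h).
by rewrite le_eqVlt; apply/orP; left; apply/eqP; ring.
Qed.

Definition rotv (t : R) a : 'rV[R]_2 := cos t *: a + sin t *: rot90 a.

Lemma rotv_circle t a : circle a -> circle (rotv t a).
Proof.
rewrite !circle_dot => a1; rewrite /rotv dotDl !dotDr !dotZl !dotZr dot_rot90K a1.
by rewrite (dotC (rot90 a)) dot_rot90 -[RHS](cos2Dsin2 t); ring.
Qed.

Lemma rotvD t s a : rotv (t + s) a = cos s *: rotv t a + sin s *: rot90 (rotv t a).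
Proof. by rewrite /rotv cosD sinD; apply: rV2P; rewrite !dot2E; ring. Qed.

(** With [d] the advance of the chord, [d <= L <= (1 + k) * d]. Replacing [d] by [L] and dropping
    the component along [u] each cost at most [k * L]. *)
Lemma arc_chord K u k p q z : compact K -> convex_set K -> circle u -> 0 < k <= 1 ->
  circle z -> first_point K u 0 p -> first_point K u k q ->
  let L := fine (area_measure K (arc u k)) in
  [/\ L <= 2 * dot (rot90 u) (q - p), - (k * L) <= dot u (q - p) <= 0,
      dot (rot90 u) (q - p) <= L
    & `|dot z (q - p) - dot z (rot90 u) * L| <= 2 * k * L].
Proof.
move=> Kc Kv u1 /andP[k0 k1] z1 fp fq L.
have [D0 e0 kDe] := first_point_chord fp fq k0.
have := le_area_measure_arc Kc Kv u1 k0 fp fq.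
have := area_measure_arc_le Kc u1 k0 fp fq.
rewrite -(fineK (area_measure_fin (arc u k) Kc)) !lee_fin -/L.
have zE : dot z (q - p) = dot z u * dot u (q - p) + dot z (rot90 u) * dot (rot90 u) (q - p).
  by rewrite (dot_frame z _ u1) (dotC u z) (dotC _ z).
rewrite zE; have := circle_dot_le u z1; rewrite u1 ler_norml => /andP[].
have := circle_dot_le (rot90 u) z1; rewrite (circle_rot90 u1) ler_norml => /andP[].
move: D0 e0 kDe; set d := dot (rot90 u) _; set e := dot u _; set b := dot z _; set c := dot z u.
move=> D0 e0 kDe b1 b2 c1 c2 h1 h2; clearbody b c d e L; clear -D0 e0 kDe b1 b2 c1 c2 h1 h2 k0 k1.
have kd : k * d <= k * L by rewrite ler_pM2l.
have kd1 : k * d <= 1 * d by rewrite ler_wpM2r.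
split; [lra|by apply/andP; split; lra|lra|].
have ce : `|c * e| <= k * L.
  rewrite normrM (ler0_norm e0) -[leRHS]mul1r ler_pM ?oppr_ge0//; last lra.
  by rewrite ler_norml c1.
have be : `|b * (d - L)| <= k * L.
  rewrite normrM -[leRHS]mul1r ler_pM//; first by rewrite ler_norml b1.
  by rewrite distrC ger0_norm; lra.
have -> : c * e + b * d - b * L = c * e + b * (d - L) by ring.
by rewrite (le_trans (ler_normD _ _))//; lra.
Qed.

(** The chords telescope from [a] to [rot90 a]. The bound on the total length makes the accumulated
    error depend only on [tan t] and the radius [r]. *)
Lemma quarter_chain K a z (n : nat) (r : R) : let t := pi / 2 / n%:R in
  let u i := rotv (i%:R * t) a in
  let L i := fine (area_measure K (arc (u i) (tan t))) in
  compact K -> convex_set K -> K !=set0 -> circle a -> circle z -> (0 < n)%N ->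
  0 < cos t -> 0 < sin t -> tan t <= 1 / 4 -> (forall x, K x -> enorm x <= r) ->
  `|dot z (face_point K (rot90 a) - face_point K a) - \sum_(0 <= i < n) dot z (rot90 (u i)) * L i|
     <= 2 * tan t * \sum_(0 <= i < n) L i
  /\ \sum_(0 <= i < n) L i <= 16 * r.
Proof.
move=> t u L Kc Kv K0 a1 z1 n0 c0 s0 k4 Kr.
pose k := tan t; pose p i := face_point K (u i).
have nn : n%:R != 0 :> R by rewrite pnatr_eq0 -lt0n.
have k0 : 0 < k by rewrite /k /tan divr_gt0.
have u0 : u 0%N = a by rewrite /u /rotv mul0r cos0 sin0 scale1r scale0r addr0.
have un : u n = rot90 a.
  by rewrite /u /rotv /t mulrC divfK// cos_pihalf sin_pihalf scale1r scale0r add0r.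
have u1 i : circle (u i) by exact: rotv_circle.
have fp i : first_point K (u i) 0 (p i) by exact: face_pointP.
have fq i : first_point K (u i) k (p i.+1).
  apply: first_point_rot => //; first exact: ltW.
  have -> : cos t *: u i + sin t *: rot90 (u i) = u i.+1; last exact: fp.
  by rewrite /u -rotvD -natr1 mulrDl mul1r.
have k4' : k <= 1 / 4 by [].
have k01 : 0 < k <= 1 by apply/andP; split; lra.
have ac i := arc_chord Kc Kv (u1 i) k01 z1 (fp i) (fq i).
have telescope v : dot v (face_point K (rot90 a) - face_point K a) =
    \sum_(0 <= i < n) dot v (p i.+1 - p i).
  under eq_bigr do rewrite dotBr.
  by rewrite telescope_sumr// dotBr /p u0 un.
split.
  rewrite telescope -sumrB mulr_sumr (le_trans (ler_norm_sum _ _ _))//.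
  by apply: ler_sum => i _; have [_ _ _] := ac i.
(* Every chord progresses along [rot90 a - a]: its part along [rot90 (u i)] contributes at least
   [d], and its part along [u i] takes away at most [d / 2], because [tan t <= 1 / 4] and
   [L i <= 2 * d]. *)
have step i : (i < n)%N -> L i <= 4 * dot (rot90 a - a) (p i.+1 - p i).
  move=> iltn; have [h1 /andP[h2 h3] h4 _] := ac i.
  pose c := cos (i%:R * t); pose s := sin (i%:R * t).
  have i0 : 0 <= i%:R * t <= pi / 2.
    have pi2 : 0 <= pi / 2 :> R by rewrite divr_ge0// pi_ge0.
    apply/andP; split; first by rewrite mulr_ge0// /t divr_ge0.
    by rewrite /t mulrCA ger_pMr ?ler_pdivrMr ?ltr0n ?mul1r ?ler_nat ?(ltnW iltn)// divr_gt0 ?pi_gt0.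
  have c_ge0 : 0 <= c by apply: cos_ge0_pihalf; case/andP: i0 => ? ?; apply/andP; split; lra.
  have s_ge0 : 0 <= s.
    by apply: sin_ge0_pi; have := pi_ge0 R; case/andP: i0 => ? ? ?; apply/andP; split; lra.
  have cs : c ^+ 2 + s ^+ 2 = 1 by exact: cos2Dsin2.
  have aa : dot a a = 1 by exact/circle_dot.
  have jj : dot (rot90 a) (rot90 a) = 1 by exact/circle_dot/circle_rot90.
  have aj : dot a (rot90 a) = 0 by exact: dot_rot90.
  have ju : rot90 (u i) = c *: rot90 a - s *: a.
    by rewrite /u /rotv -/c -/s; apply: rV2P; rewrite !dot2E; ring.
  have lu : dot (rot90 a - a) (u i) = s - c.
    rewrite /u /rotv -/c -/s dotDr !dotZr !dotDl !dotNl jj aa aj dotC aj; ring.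
  have lj : dot (rot90 a - a) (rot90 (u i)) = s + c.
    rewrite ju dotBr !dotZr !dotDl !dotNl jj aa aj dotC aj; ring.
  rewrite (dot_frame (rot90 a - a) _ (u1 i)) (dotC (u i) (rot90 a - a)) lu.
  rewrite (dotC (rot90 (u i)) (rot90 a - a)) lj.
  move: h1 h2 h3 h4; rewrite -/(L i) -/(k).
  set d := dot (rot90 (u i)) _; set e := dot (u i) _.
  move: (L i) => l; clearbody c s d e k; clear -k0 k4' c_ge0 s_ge0 cs => h1 h2 h3 h4.
  have d0 : 0 <= d by lra.
  have l0 : 0 <= l by lra.
  have sc1 : 1 <= s + c.
    rewrite -(ler_pXn2r (n := 2)) ?nnegrE ?addr_ge0// expr1n -cs sqrrD [leLHS]addrC.
    by rewrite lerD2r lerDl mulrn_wge0// mulr_ge0.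
  have [s1 c1] : s <= 1 /\ c <= 1.
    by split; rewrite -(ler_pXn2r (n := 2)) ?nnegrE// expr1n -cs ?lerDl ?lerDr sqr_ge0.
  have kl : k * l <= 1 / 4 * (2 * d) by rewrite ler_pM// (ltW k0).
  have sd : d <= (s + c) * d by rewrite ler_peMl.
  have se : - (1 / 2 * d) <= (s - c) * e.
    have : `|(s - c) * e| <= 1 * (1 / 2 * d).
      rewrite normrM (ler0_norm h3) ler_pM ?oppr_ge0//; last lra.
      by rewrite ler_norml; apply/andP; split; lra.
    by rewrite mul1r ler_norml => /andP[].
  lra.
rewrite big_nat (le_trans (ler_sum _ step))// -big_nat -mulr_sumr -telescope.
have [Kp _ _] := face_pointP a Kc K0; have [Kq _ _] := face_pointP (rot90 a) Kc K0.
have bd v x : circle v -> K x -> - r <= dot v x <= r.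
  by move=> v1 /Kr xr; rewrite -ler_norml (le_trans (circle_dot_le _ v1)).
have j1 := circle_rot90 a1.
have /andP[? ?] := bd _ _ a1 Kp; have /andP[? ?] := bd _ _ j1 Kp.
have /andP[? ?] := bd _ _ a1 Kq; have /andP[? ?] := bd _ _ j1 Kq.
by rewrite dotBr !dotDl !dotNl; lra.
Qed.

(** The radius of [D] does not enter: its total length is compared with that of [C], so [n] can be
    fixed before [D] is known. *)
Lemma quarter_chain_close C D a z (n : nat) (r e : R) : let t := pi / 2 / n%:R in
  compact C -> convex_set C -> C !=set0 -> compact D -> convex_set D -> D !=set0 ->
  circle a -> circle z -> (0 < n)%N ->
  0 < cos t -> 0 < sin t -> tan t <= 1 / 4 -> (forall x, C x -> enorm x <= r) ->
  (forall u k, `|fine (area_measure C (arc u k)) - fine (area_measure D (arc u k))| <= e) ->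
  `|dot z (face_point C (rot90 a) - face_point C a) -
    dot z (face_point D (rot90 a) - face_point D a)| <= 64 * tan t * r + 2 * n%:R * e.
Proof.
move=> t Cc Cv C0 Dc Dv D0 a1 z1 n0 c0 s0 k4 Cr CD.
have [rD _ Dr] := compact_enorm_bounded Dc.
have [hC SC] := quarter_chain Cc Cv C0 a1 z1 n0 c0 s0 k4 Cr.
have [hD _] := quarter_chain Dc Dv D0 a1 z1 n0 c0 s0 k4 Dr.
pose u i := rotv (i%:R * t) a.
pose LC i := fine (area_measure C (arc (u i) (tan t))).
pose LD i := fine (area_measure D (arc (u i) (tan t))).
have LCD i : `|LC i - LD i| <= e by exact: CD.
move: hC hD SC; rewrite -/t -/u -/LC -/LD.
have k0 : 0 < tan t by rewrite /tan divr_gt0.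
have sCD : `|\sum_(0 <= i < n) dot z (rot90 (u i)) * LC i -
    \sum_(0 <= i < n) dot z (rot90 (u i)) * LD i| <= n%:R * e.
  rewrite -sumrB (le_trans (ler_norm_sum _ _ _))//.
  apply: (@le_trans _ _ (\sum_(0 <= i < n) e)); last by rewrite sumr_const_nat subn0 mulr_natl.
  apply: ler_sum => i _; rewrite -mulrBr normrM -[leRHS]mul1r ler_pM//.
  have j1 : circle (rot90 (u i)) by apply: circle_rot90; exact: rotv_circle.
  by rewrite (le_trans (circle_dot_le _ z1))// j1.
have SD : \sum_(0 <= i < n) LD i <= \sum_(0 <= i < n) LC i + n%:R * e.
  rewrite mulr_natl -{3}(subn0 n) -sumr_const_nat -big_split/=; apply: ler_sum => i _.
  by have := LCD i; rewrite ler_norml => /andP[]; lra.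
have kSD := ler_wpM2l (ltW k0) SD.
have ne : 0 <= n%:R * e by rewrite mulr_ge0// (le_trans _ (LCD 0%N)).
have kne := ler_wpM2r ne k4.
move=> hC hD SC; have kSC := ler_wpM2l (ltW k0) SC.
rewrite -[2 * n%:R * e]mulrA; move: hC hD sCD kSD kSC kne ne; move: (dot z _) (dot z (_ - _)).
move: (\sum_(0 <= i < n) _ * _) (\sum_(0 <= i < n) _ * _).
move=> sd sc ld lc; move: (\sum_(0 <= i < n) _) (\sum_(0 <= i < n) _) => sumd sumc.
move: (n%:R * e) (tan t) => d k; rewrite !ler_norml.
by move=> /andP[? ?] /andP[? ?] /andP[? ?] ? ? ? ?; apply/andP; split; lra.
Qed.

End Chain.

(** * From surface area measures to support functions and Hausdorff distance *)

Section HausdorffDistance.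
Context {R : realType}.
Implicit Types (x y z p q u w a : 'rV[R]_2) (C D E K : set 'rV[R]_2).

Lemma small_angle (eta : R) : 0 < eta -> exists n : nat,
  [/\ (0 < n)%N, 0 < cos (pi / 2 / n%:R : R), 0 < sin (pi / 2 / n%:R : R)
    & tan (pi / 2 / n%:R) <= eta].
Proof.
move=> eta0.
have c : {for (0 : R), continuous tan} by apply: continuous_tan; rewrite cos0 oner_neq0.
have : nbhs (0 : R) [set t | tan t < eta].
  by have := cvgr_lt _ c eta; rewrite tan0; apply.
move=> /nbhs_ballP[e /= e0 he].
have p0 : (0 : R) < pi / 2 by rewrite divr_gt0 ?pi_gt0.
(* One successor compensates the truncation; the second gives [n >= 2], so that the angle stays
   below [pi / 2]. *)
pose n := (Num.truncn (pi / 2 / e)).+2; pose t : R := pi / 2 / n%:R; exists n; rewrite -/t.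
have n0 : (0 : R) < n%:R by rewrite ltr0n.
have t0 : 0 < t by rewrite divr_gt0.
have tp : t < pi / 2 by rewrite ltr_pdivrMr// ltr_pMr// ltr1n.
have te : t < e.
  rewrite /t ltr_pdivrMr// [ltRHS]mulrC -ltr_pdivrMr//.
  by apply: (lt_le_trans (truncnS_gt _)); rewrite ler_nat.
split=> //.
- by apply: cos_gt0_pihalf; rewrite tp andbT; lra.
- by apply: sin_gt0_pihalf; rewrite t0.
- by apply/ltW/he; rewrite /ball /= sub0r normrN gtr0_norm.
Qed.

(** Two quarter turns lead from [a] to [- a], a displacement of [-2] times the face point by
    symmetry; this factor absorbs the two error terms. *)
Lemma support_close C D a (n : nat) (r e : R) : let t := pi / 2 / n%:R in
  convex_disk C -> origin_symmetric C -> convex_disk D -> origin_symmetric D ->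
  circle a -> (0 < n)%N ->
  0 < cos t -> 0 < sin t -> tan t <= 1 / 4 -> (forall x, C x -> enorm x <= r) ->
  (forall u k, `|fine (area_measure C (arc u k)) - fine (area_measure D (arc u k))| <= e) ->
  `|dot a (face_point C a) - dot a (face_point D a)| <= 64 * tan t * r + 2 * n%:R * e.
Proof.
move=> t [Cc Cv C0] Cs [Dc Dv D0] Ds a1 n0 c0 s0 k4 Cr CD.
have j1 := circle_rot90 a1.
have C1 := interior_nonempty C0; have D1 := interior_nonempty D0.
have := quarter_chain_close Cc Cv C1 Dc Dv D1 a1 a1 n0 c0 s0 k4 Cr CD.
have := quarter_chain_close Cc Cv C1 Dc Dv D1 j1 a1 n0 c0 s0 k4 Cr CD.
rewrite rot90K !face_pointN// !dotBr !dotNr -/t.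
by rewrite !ler_norml => /andP[? ?] /andP[? ?]; apply/andP; split; lra.
Qed.

(** The minimiser of the distance to [x] works: a point of [D] strictly beyond the perpendicular
    through [y] would allow a step that shortens the distance. *)
Lemma nearest_point D x : compact D -> convex_set D -> D !=set0 ->
  exists2 y, D y & forall y', D y' -> dot (x - y) y' <= dot (x - y) y.
Proof.
move=> Dc Dv D0.
have [y] : exists2 y, y \in D & forall y', y' \in D -> enorm (x - y) <= enorm (x - y').
  apply: (@compact_EVT_min _ R (fun y => enorm (x - y)) D D0 Dc).
  apply: continuous_subspaceT => y.
  have h : {for y, continuous (fun y : 'rV[R]_2 => x - y)}.
    by apply: continuousB; [exact: cst_continuous|exact: cvg_id].
  exact: (continuous_comp h (@enorm_continuous R _)).
rewrite inE => Dy ymin; exists y => // y' Dy'.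
rewrite -subr_le0 -dotBr leNgt; apply/negP; set c := dot _ _ => cp.
set N := dot (y' - y) (y' - y).
have N0 : 0 <= N by exact: dot_ge0.
have Nc : 0 < N + c by rewrite ltr_wpDl.
(* A step size in []0, 1]] with [s * N < 2 * c], which makes the change of squared distance
   negative. *)
pose s := c / (N + c).
have s0 : 0 < s by rewrite divr_gt0.
have s1 : s <= 1 by rewrite ler_pdivrMr// mul1r lerDr.
have Ds : D (s *: y' + (1 - s) *: y) by apply: convex_seg => //; rewrite (ltW s0).
have := ymin _ (mem_set Ds); rewrite -(ler_pXn2r (n := 2)) ?nnegrE ?enorm_ge0//.
rewrite !enorm_sqr.
have -> : x - (s *: y' + (1 - s) *: y) = (x - y) + (- s) *: (y' - y).
  by apply: rV2P; rewrite !mxE; ring.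
have sqr (v w : 'rV[R]_2) (k : R) :
    dot (v + k *: w) (v + k *: w) = dot v v + 2 * k * dot v w + k ^+ 2 * dot w w.
  by rewrite !dot2E; ring.
rewrite sqr -/c -/N => h.
have : 0 <= s * (s * N - 2 * c) by lra.
rewrite pmulr_rge0// subr_ge0 => h2.
have : s * (N + c) = c by rewrite divfK// gt_eqF.
have sc : 0 < s * c by rewrite mulr_gt0.
by rewrite mulrDr; lra.
Qed.

(** For [y] nearest to [x] and [u] the unit vector from [y] to [x], the point [y] attains the
    support function of [D] at [u]; hence the distance is at most the gap between the support
    functions. *)
Lemma near_of_support_le C D (e : R) : compact C -> C !=set0 -> compact D -> convex_set D ->
  D !=set0 -> 0 <= e ->
  (forall u, circle u -> dot u (face_point C u) <= dot u (face_point D u) + e) ->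
  forall x, C x -> exists2 y, D y & enorm (x - y) <= e.
Proof.
move=> Cc C0 Dc Dv D0 e0 CD x Cx.
have [y Dy ymax] := nearest_point x Dc Dv D0.
exists y => //; have [->//|xy0] := eqVneq (enorm (x - y)) 0.
have n0 : 0 < enorm (x - y) by rewrite lt_neqAle eq_sym xy0 enorm_ge0.
pose u := (enorm (x - y))^-1 *: (x - y).
have uE z : dot u z = (enorm (x - y))^-1 * dot (x - y) z by rewrite dotZl.
have u1 : circle u.
  by rewrite circle_dot uE dotZr -enorm_sqr expr2 mulKf// mulVf.
have := CD u u1.
have [_ /(_ _ Cx)] := face_pointP u Cc C0; rewrite !mul0r !addr0 => h1 _.
have [/ymax + _ _] := face_pointP u Dc D0.
rewrite -(ler_pM2l (_ : 0 < (enorm (x - y))^-1)) ?invr_gt0// -!uE.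
have : dot u (x - y) = enorm (x - y) by rewrite uE -enorm_sqr expr2 mulKf.
rewrite dotBr; lra.
Qed.

Lemma hausdorff_dist_le C D (e : R) : 
  (forall x, C x -> exists2 y, D y & enorm (x - y) <= e) ->
  (forall x, D x -> exists2 y, C y & enorm (x - y) <= e) ->
  (hausdorff_dist C D <= e%:E)%E.
Proof.
move=> CD DC; rewrite /hausdorff_dist ge_max; apply/andP; split.
  apply: ge_ereal_sup => _ [x /CD[y Dy xy] <-].
  by apply: ge_ereal_inf; exists (enorm (x - y))%:E => //; exists y.
apply: ge_ereal_sup => _ [x /DC[y Dy xy] <-].
by apply: ge_ereal_inf; exists (enorm (x - y))%:E => //; exists y.
Qed.

Lemma hausdorff_dist_lt C D (e : R) : (hausdorff_dist C D < e%:E)%E ->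
  (forall x, C x -> exists2 y, D y & enorm (x - y) <= e) /\
  (forall x, D x -> exists2 y, C y & enorm (x - y) <= e).
Proof.
rewrite /hausdorff_dist gt_max => /andP[h1 h2].
have near A B x : (ereal_sup [set dist_to p B | p in A] < e%:E)%E -> A x ->
    exists2 y, B y & enorm (x - y) <= e.
  move=> h Ax; have : (dist_to x B < e%:E)%E.
    by apply: le_lt_trans h; apply: ereal_sup_ubound; exists x.
  by move=> /ereal_inf_lt[_ [y By <-]]; rewrite lte_fin => /ltW; exists y.
by split=> x; exact: near.
Qed.

Lemma perimeter_measure_dist_lt C D (d : R) sigma : compact C -> compact D ->
  circle_borel sigma -> (perimeter_measure_dist C D < d%:E)%E ->
  `|fine (area_measure C sigma) - fine (area_measure D sigma)|
    <= d * fine (hausdorff1 (@circle R)).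
Proof.
move=> Cc Dc sb /ereal_inf_lt[_ [tau [tau0 /(_ _ sb) h] <-]]; rewrite lte_fin => taud.
rewrite -lee_fin EFinM (fineK hausdorff1_circle_fin).
rewrite -abse_EFin EFinB !fineK ?area_measure_fin//; apply: (le_trans h).
apply: (@le_trans _ _ (tau%:E * hausdorff1 (@circle R))%E).
  by apply: lee_wpmul2l; rewrite ?lee_fin// le_hausdorff1//; case: sb.
by apply: lee_wpmul2r; [exact: hausdorff1_ge0|rewrite lee_fin ltW].
Qed.

Lemma perimeter_measure_dist_refl C : compact C -> perimeter_measure_dist C C = 0%E.
Proof.
move=> Cc; apply/eqP; rewrite eq_le; apply/andP; split.
  apply: ereal_inf_lbound; exists 0 => //; split=> // s _.
  by rewrite subee ?area_measure_fin// abse0 mul0e.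
by apply: le_ereal_inf_tmp => _ [tau [tau0 _] <-]; rewrite lee_fin.
Qed.

End HausdorffDistance.

(** * Comparison of the two topologies *)

Lemma dPM_dH_continuous (R : realType) (C : Ko R) (e : R) : 0 < e ->
  exists2 d : R, 0 < d & forall D : Ko R, (dPM C D < d%:E)%E -> (dH C D <= e%:E)%E.
Proof.
move=> e0; have [[Cc Cv C0] Cs] := set_valP C.
have [r r0 Cr] := compact_enorm_bounded Cc.
(* [1 / 4] is what the chain estimate requires; the other bound makes [64 * tan t * r] at most
   [e / 2]. *)
have [|n [n0 c0 s0 tn]] := @small_angle R (Num.min (1 / 4) (e / (128 * r))).
  by rewrite lt_min; apply/andP; split; [lra|rewrite divr_gt0 ?mulr_gt0].
move: tn; rewrite le_min => /andP[t4 te].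
pose M := fine (hausdorff1 (@circle R)).
have M0 : 0 <= M by rewrite fine_ge0// hausdorff1_ge0.
have nR : (0 : R) < n%:R by rewrite ltr0n.
(* Chosen so that the error over the arcs is at most [e / 2]; [M + 1] avoids a zero denominator. *)
exists (e / (4 * n%:R * (M + 1))); first by rewrite divr_gt0 ?mulr_gt0//; lra.
move=> D CD; have [[Dc Dv D0] Ds] := set_valP D.
have close u : circle u ->
    `|dot u (face_point (val C) u) - dot u (face_point (val D) u)| <= e.
  move=> u1; apply: (le_trans (@support_close _ _ _ u n r
    (e / (4 * n%:R * (M + 1)) * M) _ Cs _ Ds u1 n0 c0 s0 t4 Cr _)) => //.
    by move=> v k; apply: perimeter_measure_dist_lt => //; exact: arc_borel.
  have h1 : 64 * tan (pi / 2 / n%:R) * r <= e / 2.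
    move: te; rewrite ler_pdivlMr ?mulr_gt0//; lra.
  have h2 : 2 * n%:R * (e / (4 * n%:R * (M + 1)) * M) <= e / 2.
    have -> : 2 * n%:R * (e / (4 * n%:R * (M + 1)) * M) = e / 2 * (M / (M + 1)).
      by field; apply/andP; split; rewrite gt_eqF//; lra.
    rewrite ler_piMr//; first lra.
    by rewrite ler_pdivrMr; lra.
  lra.
have C1 := interior_nonempty C0; have D1 := interior_nonempty D0.
apply: hausdorff_dist_le.
- apply: near_of_support_le => //; first exact: ltW.
  by move=> u /close; rewrite ler_norml => /andP[]; lra.
- apply: near_of_support_le => //; first exact: ltW.
  by move=> u /close; rewrite ler_norml => /andP[]; lra.
Qed.

(** The continuity estimate is applied at [D], an arbitrary point of the Hausdorff ball, and
    combined with the triangle inequality. *)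
Lemma dH_ball_dPM_ball (R : realType) (C D : Ko R) (r : R) : (dH C D < r%:E)%E ->
  exists2 d : R, 0 < d & gball (@dPM R) D d `<=` gball (@dH R) C r.
Proof.
move=> CDr.
have CD0 : (0 <= dH C D)%E.
  have [[_ _ [x /interior_subset Cx]] _] := set_valP C.
  rewrite /dH /hausdorff_dist le_max; apply/orP; left.
  apply: (@le_trans _ _ (dist_to x (val D))); last by apply: ereal_sup_ubound; exists x.
  by apply: le_ereal_inf_tmp => _ [y _ <-]; rewrite lee_fin enorm_ge0.
have CDfin : dH C D \is a fin_num by rewrite ge0_fin_numE// (lt_trans CDr)// ltry.
pose s := fine (dH C D).
have sE : dH C D = s%:E by rewrite fineK.
have sr : s < r by rewrite -lte_fin -sE.
(* The nearest points lie within [s + e] and [e + e], where the slack turns weak bounds into strict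
   ones; in total [s + 3 * e < r]. *)
pose e := (r - s) / 4.
have e0 : 0 < e by rewrite /e; lra.
have [d d0 hd] := dPM_dH_continuous D e0.
exists d => // E /= /hd DE; rewrite /gball /=.
have /hausdorff_dist_lt[CD DC] : (hausdorff_dist (val C) (val D) < (s + e)%:E)%E.
  by rewrite -/(dH C D) sE lte_fin; lra.
have /hausdorff_dist_lt[DE' ED'] : (hausdorff_dist (val D) (val E) < (e + e)%:E)%E.
  by apply: (le_lt_trans DE); rewrite lte_fin; lra.
apply: (@le_lt_trans _ _ (s + e + (e + e))%:E); last by rewrite lte_fin /e; lra.
apply: hausdorff_dist_le => x.
- move=> /CD[y /DE'[z Ez yz] xy]; exists z => //.
  by rewrite (le_trans (ler_enormB x y z))//; lra.
- move=> /ED'[y /DC[z Ez yz] xy]; exists z => //.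
  by rewrite (le_trans (ler_enormB x y z))//; lra.
Qed.

Lemma gball_open (R : realType) (T : choiceType) (d : T -> T -> \bar R) (x : T) (r : R) :
  0 < r -> gmetric_open d (gball d x r).
Proof.
move=> r0; exists [set gball d x r]; last by rewrite bigcup_set1.
move=> _ ->; exists [fset (gball d x r)]%fset; last by rewrite set_fset1 bigcap_set1.
by move=> A; rewrite in_fset1 => /eqP ->; rewrite inE; exists x, r.
Qed.

Theorem corollary1 (R : realType) (U : set (Ko R)) :
  gmetric_open (@dH R) U -> gmetric_open (@dPM R) U.
Proof.
move=> [F sF <-]; rewrite /gmetric_open openE => D [A FA AD].
have [G sG GA] := sF _ FA.
pose T := gmetric_type (@dPM R).
have : nbhs (D : T) (\bigcap_(i in [set` G]) i).
  (* The balls form a subbase, so around [D] it suffices to treat each of the finitely many balls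
     whose intersection is [A]. *)
  apply: filter_bigI => B BG.
  have := sG B BG; rewrite inE => -[C [r [r0 BE]]].
  have CDr : gball (@dH R) C r D by rewrite -BE; move: AD; rewrite -GA; exact.
  have [d d0 sub] := dH_ball_dPM_ball CDr.
  rewrite BE; apply: (@filterS T _ _ _ _ sub); apply: open_nbhs_nbhs; split.
    exact: gball_open.
  have [[Dc _ _] _] := set_valP D.
  by rewrite /gball /= /dPM perimeter_measure_dist_refl.
by apply: filterS => E GE; exists A => //; rewrite -GA.
Qed.
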